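(* Let $\mathbf{C}$ be one of the following classes: the class of all cones, the class of all cancellative cones, or the class of all separative cones. Then every simple element of $\mathbf{C}$ embeds unitarily into a simple normally divisible refinement cone belonging to $\mathbf{C}$.
   Context: Commutative monoids are written additively. The algebraic preordering of a commutative monoid $M$ is $x\le y\iff(\exists z\in M)(x+z=y)$. A cone is a commutative monoid that is conical: $x+y=0\Rightarrow x=y=0$. It is cancellative if $x+z=y+z\Rightarrow x=y$, and separative if $2x=x+y=2y\Rightarrow x=y$. An order-unit of $M$ is $u\in M$ such that every $x\in M$ satisfies $x\le nu$ for some positive integer $n$. $M$ is simple if every $u\in M$ with $u\not\le 0$ is an order-unit of $M$. A refinement cone is a cone with the refinement property: whenever $a_0+a_1=b_0+b_1$ there are $c_{ij}$ ($i,j<2$) with $a_i=c_{i0}+c_{i1}$ and $b_i=c_{0i}+c_{1i}$ for all $i<2$. A commutative monoid $M$ is normally divisible if for every positive integer $p$, every finite subset $X\subseteq M$ and every $a\in M$, there is $u\in M$ with $pu=a$ and, for all $x,y\in X$, $x+a=y+a\Rightarrow x+u=y+u$. A homomorphism $f:A\to B$ of commutative monoids is unitary if it is one-to-one, has cofinal image (every $b\in B$ satisfies $b\le f(a)$ for some $a\in A$), and for all $a_0,a_1\in A$, $b\in B$, $f(a_0)+b=f(a_1)$ implies $b\in f[A]$. ''$A$ embeds unitarily into $B$'' means there is a unitary homomorphism $A\to B$. *)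

(* Defs.v *)
From HB Require Import structures.
From mathcomp Require Import all_boot all_algebra finmap.

Set Implicit Arguments.
Unset Strict Implicit.
Unset Printing Implicit Defensive.

Local Open Scope ring_scope.

(* Commutative monoids are [nmodType]s: the choice operator they carry is no
   restriction classically, and is used only to form finite sets [{fset M}]. *)

Definition alg_le (M : nmodType) (x y : M) : Prop := exists z : M, x + z = y.

Definition order_unit (M : nmodType) (u : M) : Prop :=
  forall x : M, exists2 n : nat, (0 < n)%N & alg_le x (u *+ n).

Definition simple_monoid (M : nmodType) : Prop :=
  forall u : M, ~ alg_le u 0 -> order_unit u.

Definition conical (M : nmodType) : Prop :=
  forall x y : M, x + y = 0 -> x = 0 /\ y = 0.

Definition cancellative (M : nmodType) : Prop :=
  forall x y z : M, x + z = y + z -> x = y.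

Definition separative (M : nmodType) : Prop :=
  forall x y : M, x *+ 2 = x + y -> x + y = y *+ 2 -> x = y.

Definition cone (M : nmodType) : Prop := conical M.

Definition cancellative_cone (M : nmodType) : Prop := cone M /\ cancellative M.

Definition separative_cone (M : nmodType) : Prop := cone M /\ separative M.

Definition refinement_property (M : nmodType) : Prop :=
  forall a0 a1 b0 b1 : M, a0 + a1 = b0 + b1 ->
  exists c00 c01 c10 c11 : M,
    [/\ a0 = c00 + c01, a1 = c10 + c11, b0 = c00 + c10 & b1 = c01 + c11].

Definition refinement_cone (M : nmodType) : Prop :=
  cone M /\ refinement_property M.

Definition normally_divisible (M : nmodType) : Prop :=
  forall (p : nat) (X : {fset M}) (a : M), (0 < p)%N ->
  exists u : M, u *+ p = a /\
    forall x y : M, x \in X -> y \in X -> x + a = y + a -> x + u = y + u.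

Definition unitary (A B : nmodType) (f : {additive A -> B}) : Prop :=
  [/\ injective f,
      forall b : B, exists a : A, alg_le b (f a) &
      forall (a0 a1 : A) (b : B), f a0 + b = f a1 -> exists a : A, f a = b].

Definition embeds_unitarily (A B : nmodType) : Prop :=
  exists f : {additive A -> B}, unitary f.

(* Main.v *)
Require Import Defs.
From HB Require Import structures.
From mathcomp Require Import all_boot all_algebra finmap.
From mathcomp Require Import zify boolp functions.

(** Let a unitary submonoid of a commutative monoid [A] carry a homomorphism onto
    [M], seen as a partial "value" [A -> M].  Dividing [A] by its syntactic
    congruence ([a ~ b] iff [a + c] and [b + c] have the same value, or both
    none, for every [c]) gives a unitary extension of [M]; it is
    cancellative or separative as soon as [M] is, because an equation in the
    quotient can be tested, after adding some [c], on values in [M].  Take for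
    [A] the sum of [M] and of the free commutative monoid on formal solutions
    of all refinement and division problems of [M]; an element has a value when
    it is homogeneous of degree zero: for each refinement problem the formal
    2x2 matrix has equal diagonal sums, for each division by [p] the number of
    formal quotients is a multiple of [p].  Iterating [omega] times, any cone
    embeds unitarily into a normally divisible refinement cone [P] of its class.

    If [M] is simple, keep only [0] and the order-units of [P].  Refinements
    survive: given a refinement of order-units with entries [4 e_ij], the common
    parts of [e_00], [e_11] and of [e_01], [e_10] together generate [P], and
    moving them across the matrix makes all four entries order-units. *)

Set Implicit Arguments.
Unset Strict Implicit.
Unset Printing Implicit Defensive.

Import GRing.Theory.
Local Open Scope ring_scope.

(** * Quotients of submonoids and the syntactic quotient *)

Lemma additive_of (A B : nmodType) (f : A -> B) :
  f 0 = 0 -> (forall x y, f (x + y) = f x + f y) ->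
  exists g : {additive A -> B}, forall x, g x = f x.
Proof.
move=> f0 fD.
have fP : nmod_morphism f by split.
pose g : {additive A -> B} :=
  HB.pack f (GRing.isNmodMorphism.Build A B f fP).
by exists g.
Qed.

(** Elements of [Q] are the classes [R x] taken as predicates, so that extensionality turns [R] into
    equality. The monoid laws are asked only up to [R]; syntactic quotients, colimits and submonoids
    are all instances. *)
Lemma subquotient (A : Type) (zero : A) (add : A -> A -> A)
    (D : A -> Prop) (R : A -> A -> Prop) :
    D zero -> (forall x y, D x -> D y -> D (add x y)) ->
    (forall x, R x x) -> (forall x y, R x y -> R y x) ->
    (forall x y z, R x y -> R y z -> R x z) ->
    (forall x y z, R x y -> R (add x z) (add y z)) ->
    (forall x y z, R (add x (add y z)) (add (add x y) z)) ->
    (forall x y, R (add x y) (add y x)) ->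
    (forall x, R (add zero x) x) ->
  exists (Q : nmodType) (pi : A -> Q),
    [/\ forall q, exists2 x, D x & pi x = q,
        pi zero = 0,
        forall x y, D x -> D y -> pi (add x y) = pi x + pi y &
        forall x y, D x -> D y -> pi x = pi y <-> R x y].
Proof.
move=> D0 DD Rxx Rsym Rtrans RD RA RC R0.
pose T := {classic {S : A -> Prop | exists2 x, D x & S = R x}}.
(* Elements outside [D] default to [zero], which makes [cls] total. *)
pose nf x := if pselect (D x) then x else zero.
have Dnf x : D (nf x) by rewrite /nf; case: (pselect (D x)).
have nfE x : D x -> nf x = x by rewrite /nf; case: (pselect (D x)).
have clsP x : exists2 y, D y & R (nf x) = R y by exists (nf x).
pose cls x : T := exist _ _ (clsP x).
have repP (q : T) : exists x, D x /\ cls x = q.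
  case: q => S SP; case: (SP) => x Dx Sx; exists x; split=> //.
  by apply: eq_exist; rewrite nfE.
pose rep q := sval (cid (repP q)).
have Drep q : D (rep q) by rewrite /rep; case: cid => x [].
have repK q : cls (rep q) = q by rewrite /rep; case: cid => x [].
have clsE x y : D x -> D y -> cls x = cls y <-> R x y.
  move=> Dx Dy; split=> [/(congr1 sval)/=|xy].
    by rewrite !nfE // => ->.
  apply: eq_exist; rewrite !nfE //.
  by apply: funext => z; apply: propext; split; apply: Rtrans => //; apply: Rsym.
pose addT p q := cls (add (rep p) (rep q)).
have clsD x y : D x -> D y -> cls (add x y) = addT (cls x) (cls y).
  move=> Dx Dy; apply/clsE; [exact: DD|by apply: DD; exact: Drep|].
  have xr z : D z -> R z (rep (cls z)) by move=> Dz; apply/clsE => //; rewrite repK.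
  apply: (Rtrans _ (add (rep (cls x)) y)); first exact/RD/xr.
  apply: (Rtrans _ (add y (rep (cls x)))); first exact: RC.
  by apply: (Rtrans _ (add (rep (cls y)) (rep (cls x)))); [exact/RD/xr|exact: RC].
have addTA : associative addT.
  move=> p q r; rewrite -(repK p) -(repK q) -(repK r).
  have [Dp Dq Dr] := And3 (Drep p) (Drep q) (Drep r).
  have [Dpq Dqr] := (DD _ _ Dp Dq, DD _ _ Dq Dr).
  by rewrite -!clsD //; apply/clsE => //; apply: DD.
have addTC : commutative addT.
  move=> p q; rewrite -(repK p) -(repK q).
  by rewrite -!clsD //; apply/clsE => //; do ?apply: DD => //.
have add0T : left_id (cls zero) addT.
  by move=> p; rewrite -(repK p) -!clsD //; apply/clsE => //; apply: DD.
pose Q : nmodType := HB.pack T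
  (GRing.isNmodule.Build T addTA addTC add0T).
by exists Q, cls; split=> // q; exists (rep q).
Qed.

Definition preserves_classes (A B : nmodType) : Prop :=
  [/\ conical A -> conical B, cancellative A -> cancellative B
    & separative A -> separative B].

(* [V a m] reads: [a] has value [m].  [D] cuts out the elements of [A] that are
   bounded by elements with a value, so that [M] is cofinal in the quotient. *)
Lemma syntactic_extension (A M : nmodType) (D : A -> Prop)
    (V : A -> M -> Prop) :
    D 0 -> (forall a b, D a -> D b -> D (a + b)) ->
    (forall a m n, V a m -> V a n -> m = n) ->
    V 0 0 -> (forall a b m n, V a m -> V b n -> V (a + b) (m + n)) ->
    (forall a b m n, V a m -> V (a + b) n -> exists k, V b k) ->
    (forall m, exists2 a, D a & V a m) ->
    (forall a, D a -> exists b m, D b /\ V (a + b) m) ->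
    (forall a b, V (a + b) 0 -> V a 0) ->
  exists (N : nmodType) (h : {additive M -> N}) (pi : A -> N),
    [/\ unitary h, preserves_classes M N,
        forall a b, D a -> D b -> pi (a + b) = pi a + pi b,
        forall a m, D a -> V a m -> pi a = h m &
        forall a b, D a -> D b ->
          (forall c m, V (a + c) m <-> V (b + c) m) -> pi a = pi b].
Proof.
move=> D0 DD Vfun V0 VD VB Vsurj Vcof Vrefl.
pose R a b := forall c m, V (a + c) m <-> V (b + c) m.
have Raa a : R a a by [].
have Rsym a b : R a b -> R b a by move=> H c m; split=> /H.
have Rtr a b c : R a b -> R b c -> R a c.
  by move=> H K d m; split=> [/H/K|/K/H].
have RD a b c : R a b -> R (a + c) (b + c).
  by move=> H d m; rewrite -!addrA.
have [||x|N [pi [pisurj pi0 piD piE]]] :=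
  subquotient D0 DD Raa Rsym Rtr RD; first by move=> x y z; rewrite addrA.
- by move=> x y; rewrite addrC.
- by rewrite add0r.
have Vsub a b m n : V a m -> V (a + b) n -> exists2 k, V b k & n = m + k.
  move=> Va Vab; have [k Vk] := VB _ _ _ _ Va Vab.
  by exists k => //; apply: Vfun Vab _; apply: VD.
(* By [Vsub] the value of [a + c] is [m] plus the value of [c], so it depends on [a] only through
   [m]. *)
have VR a b m : V a m -> V b m -> R a b.
  move=> Va Vb c n; split=> H.
    by have [k Vk ->] := Vsub _ _ _ _ Va H; apply: VD.
  by have [k Vk ->] := Vsub _ _ _ _ Vb H; apply: VD.
have [r rP] := choice (fun m => let: ex_intro2 a Da Va := Vsurj m in
  ex_intro (fun a => D a /\ V a m) a (conj Da Va)).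
have Dr m : D (r m) by have [] := rP m.
have Vr m : V (r m) m by have [] := rP m.
have piV a m : D a -> V a m -> pi a = pi (r m).
  by move=> Da Va; apply/piE => //; apply: VR Va _.
have [h hE] : exists h : {additive M -> N}, forall m, h m = pi (r m).
  apply: additive_of => [|m n]; first by rewrite -(piV 0).
  by rewrite -piD // -(piV (r m + r n)) //; [exact: DD|exact: VD].
exists N, h, pi; split=> //; first split.
- move=> m n; rewrite !hE => /(piE _ _ (Dr m) (Dr n))/(_ 0 m)[+ _].
  by rewrite !addr0 => /(_ (Vr m)) H; apply: Vfun H (Vr n).
- move=> q; have [a Da <-] := pisurj q.
  have [b [m [Db Vm]]] := Vcof a Da; exists m, (pi b).
  by rewrite hE -piD // (piV (a + b) m) //; apply: DD.
- move=> m n q; have [a Da <-] := pisurj q; rewrite !hE -piD //.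
  move=> /(piE _ _ (DD _ _ (Dr m) Da) (Dr n))/(_ 0 n)[_].
  rewrite !addr0 => /(_ (Vr n)) /(VB _ _ _ _ (Vr m))[k Vk].
  by exists k; rewrite hE -(piV a).
- split=> [_ p q|canM p q s|sepM p q].
  + have [a Da <-] := pisurj p; have [b Db <-] := pisurj q.
    rewrite -piD // -{1}pi0 => /(piE _ _ (DD _ _ Da Db) D0)/(_ 0 0)[_].
    rewrite !addr0 => /(_ V0) Vab.
    have z c : D c -> V c 0 -> pi c = 0.
      by move=> Dc Vc; rewrite -pi0; apply/piE => //; apply: VR Vc V0.
    split; apply: z => //; first exact: Vrefl Vab.
    by apply: (Vrefl _ a); rewrite addrC.
  + have [a Da <-] := pisurj p; have [b Db <-] := pisurj q.
    have [c Dc <-] := pisurj s; rewrite -!piD //.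
    move=> /(piE _ _ (DD _ _ Da Dc) (DD _ _ Db Dc)) H; apply/piE => // z m.
    wlog suff: a b Da Db H / V (a + z) m -> V (b + z) m.
      move=> W; split; first exact: W.
      by apply: W => // ? ?; split=> /H.
    (* Adding [d] completes [c] to an element of value [n]. The congruence of [a + c] and [b + c]
       can then be tested in the context [z + d], and [n] cancels in [M]. *)
    have [d [n [Dd Vn]]] := Vcof c Dc => Vm.
    have E x : x + c + (z + d) = (c + d) + (x + z).
      by rewrite addrACA addrC.
    have := VD _ _ _ _ Vn Vm; rewrite -E => /H; rewrite E => H1.
    have [k Vk e] := Vsub _ _ _ _ Vn H1.
    by rewrite (canM m k n) // addrC e addrC.
  + have [a Da <-] := pisurj p; have [b Db <-] := pisurj q.
    rewrite !mulr2n -!piD // => /(piE _ _ (DD _ _ Da Da) (DD _ _ Da Db)) H1.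
    move=> /(piE _ _ (DD _ _ Da Db) (DD _ _ Db Db)) H2.
    apply/piE => // z m.
    wlog suff: a b Da Db H1 H2 / V (a + z) m -> V (b + z) m.
      move=> W; split; first exact: W.
      by apply: W => // c n; rewrite (addrC b a); apply: iff_sym.
    (* With [m] and [k] the values of [a + z] and [b + z], the two congruences tested in the context
       [z + z] give [m + m = m + k = k + k]. *)
    move=> Vm; have := VD _ _ _ _ Vm Vm; rewrite addrACA => /H1 Vab.
    move: (Vab) => /H2; rewrite addrACA => Vbb.
    move: Vab; rewrite addrACA => Vab.
    have [k Vk e] := Vsub _ _ _ _ Vm Vab.
    have e2 : m + k = k + k by apply: Vfun (VD _ _ _ _ Vk Vk); rewrite -e.
    by rewrite (sepM m k) // mulr2n.
- by move=> a m Da Va; rewrite hE -(piV a).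
- by move=> a b Da Db ab; apply/piE.
Qed.

(** * Adjoining a family of gadgets to a monoid *)

(* [g] is the graph of a homomorphism to [M] from a unitary cofinal submonoid of
   [V]. *)
Record gadget (M V : nmodType) (g : V -> M -> Prop) : Prop := Gadget {
  gadget_fun : forall v m n, g v m -> g v n -> m = n;
  gadget0 : g 0 0;
  gadgetD : forall v w m n, g v m -> g w n -> g (v + w) (m + n);
  gadget_sub : forall v w m n, g v m -> g (v + w) n -> exists k, g w k;
  gadget_cof : forall v, exists w m, g (v + w) m;
  gadget_eq0 : forall v w, g (v + w) 0 -> g v 0 }.

(** One half of the congruence between [x] plus [v] and [y] plus [w], tested only on the coordinate
    where [v] and [w] live. *)
Definition exchange (M V : nmodType) (g : V -> M -> Prop) x v y w : Prop :=
  forall u m, g (v + u) m -> exists2 n, g (w + u) n & x + m = y + n.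

Lemma sum_widen (M : nmodType) (I : choiceType) (S T : {fset I}) (mu : I -> M) :
  (forall i, i \notin S -> mu i = 0) ->
  \sum_(i <- (S `|` T)%fset) mu i = \sum_(i <- S) mu i.
Proof.
move=> mu0; symmetry; apply: big_fset_incl; first exact: fsubsetUl.
by move=> i _ /mu0.
Qed.

(** This is the syntactic extension for [M] plus one copy of [V] per gadget, values being added over
    the coordinates. Since [M] is conical, a zero total forces every coordinate value to vanish. *)
Lemma gadget_extension (M V : nmodType) (I : choiceType)
    (g : I -> V -> M -> Prop) :
    conical M -> (forall i, gadget (g i)) ->
  exists (N : nmodType) (h : {additive M -> N}) (k : I -> V -> N),
    [/\ unitary h, preserves_classes M N,
        forall i v w, k i (v + w) = k i v + k i w,
        forall i v m, g i v m -> k i v = h m &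
        forall i x v y w, exchange (g i) x v y w -> exchange (g i) y w x v ->
          h x + k i v = h y + k i w].
Proof.
move=> conM gP.
pose A : nmodType := (M * (I -> V))%type.
(* Finite support cuts the direct sum out of the full product. *)
pose D (a : A) := exists S : {fset I}, forall i, i \notin S -> a.2 i = 0.
pose W (a : A) m := exists (S : {fset I}) (mu : I -> M),
  [/\ forall i, g i (a.2 i) (mu i), forall i, i \notin S -> mu i = 0
    & m = a.1 + \sum_(i <- S) mu i].
have addE (a b : A) i : (a + b).2 i = a.2 i + b.2 i by [].
have D0 : D 0 by exists (fset0 : {fset I}).
have DD a b : D a -> D b -> D (a + b).
  move=> [S Sa] [T Tb]; exists (S `|` T)%fset => i; rewrite in_fsetU negb_or.
  by move=> /andP[/Sa ai /Tb bi]; rewrite addE ai bi addr0.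
have Wfun a m n : W a m -> W a n -> m = n.
  move=> [S [mu [gmu mu0 ->]]] [T [nu [gnu nu0 ->]]]; congr (_ + _).
  have E : mu = nu.
    by apply: funext => i; exact: gadget_fun (gP i) _ _ _ (gmu i) (gnu i).
  by rewrite -(sum_widen T mu0) E fsetUC sum_widen.
have W0 : W 0 0.
  exists (fset0 : {fset I}), (fun=> 0); split=> // [i|].
    exact: gadget0.
  by rewrite big1 ?addr0.
have WD a b m n : W a m -> W b n -> W (a + b) (m + n).
  move=> [S [mu [gmu mu0 ->]]] [T [nu [gnu nu0 ->]]].
  exists (S `|` T)%fset, (fun i => mu i + nu i); split.
  - by move=> i; exact: gadgetD.
  - by move=> i; rewrite in_fsetU negb_or => /andP[/mu0-> /nu0->]; rewrite addr0.
  - by rewrite big_split /= sum_widen // fsetUC sum_widen // addrACA.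
have WB a b m n : W a m -> W (a + b) n -> exists k, W b k.
  move=> [S [mu [gmu mu0 _]]] [T [nu [gnu nu0 _]]].
  have [ka kaP] := choice (fun i => gadget_sub (gP i) (gmu i) (gnu i)).
  exists (b.1 + \sum_(i <- (S `|` T)%fset) ka i).
  exists (S `|` T)%fset, ka; split=> // i.
  rewrite in_fsetU negb_or => /andP[/mu0 mui /nu0 nui].
  (* Outside both supports the values of [a] and [a + b] are zero, so functionality of the gadget
     forces [ka i = 0]. *)
  have := gadgetD (gP i) (gmu i) (kaP i); rewrite mui add0r => gk.
  by apply: gadget_fun (gP i) _ _ _ gk _; rewrite -nui; exact: gnu.
have Wsurj m : exists2 a, D a & W a m.
  exists (m, 0); first by exists (fset0 : {fset I}).
  exists (fset0 : {fset I}), (fun=> 0); split=> // [i|]; first exact: gadget0.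
  by rewrite big1 ?addr0.
have Wcof a : D a -> exists b m, D b /\ W (a + b) m.
  move=> [S aS]; have [w wP] := choice (fun i => gadget_cof (gP i) (a.2 i)).
  have [mu muP] := choice wP.
  (* The chosen complements [w] may be nonzero everywhere; truncating them to [S] is harmless
     because [a] vanishes outside [S]. *)
  pose f i := if i \in S then w i else 0.
  exists (0, f), (a.1 + 0 + \sum_(i <- S) if i \in S then mu i else 0); split.
    by exists S => i /= iS; rewrite /f (negbTE iS).
  exists S, (fun i => if i \in S then mu i else 0); split=> // i; last first.
    by move=> /negbTE->.
  rewrite addE /= /f; case: ifPn => // /aS->.
  by rewrite addr0; exact: gadget0.
have Wrefl a b : W (a + b) 0 -> W a 0.
  move=> [S [mu [gmu mu0]]] /esym/conM[/conM[a0 _] /eqP sum0].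
  exists S, (fun=> 0); split=> //; last by rewrite a0 big1 ?addr0.
  move=> i; apply: (gadget_eq0 (gP i) (w := b.2 i)).
  suff <- : mu i = 0 by exact: gmu.
  have [iS|/mu0//] := boolP (i \in S).
  by move/eqP: sum0; rewrite (big_fsetD1 i) // => /conM[].
have [N [h [pi [hU NM piD piV piE]]]] :=
  syntactic_extension D0 DD Wfun W0 WD WB Wsurj Wcof Wrefl.
pose d i v : A := (0, fun j => if j == i then v else 0).
have Dd x i v : D (x, (d i v).2).
  by exists [fset i]%fset => j; rewrite in_fset1 /= => /negbTE->.
have hpi x i v : h x + pi (d i v) = pi (x, (d i v).2).
  have W1 : W (x, 0) x.
    exists (fset0 : {fset I}), (fun=> 0); split=> // [j|]; first exact: gadget0.
    by rewrite big1 ?addr0.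
  have D1 : D (x, 0) by exists (fset0 : {fset I}).
  rewrite -(piV _ _ D1 W1) -piD //; last exact: Dd.
  by congr (pi (_, _)); [exact: addr0|apply: funext => j; exact: add0r].
have ex1 i x v y w c m : exchange (g i) x v y w ->
    W ((x, (d i v).2) + c) m -> W ((y, (d i w).2) + c) m.
  move=> xvyw [S [mu [gmu mu0 ->]]].
  have := gmu i; rewrite addE /= eqxx.
  move=> /xvyw[n gn xy].
  (* Only the value at [i] changes; the support is widened to contain [i] so that this term can be
     split off the sum. *)
  exists (S `|` [fset i])%fset, (fun j => if j == i then n else mu j); split.
  - move=> j; have := gmu j; rewrite !addE /=.
    by case: eqP => [->|].
  - by move=> j; rewrite in_fsetU in_fset1 negb_or => /andP[/mu0 + /negbTE->].
  - rewrite -(sum_widen [fset i]%fset mu0).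
    have iS : i \in (S `|` [fset i])%fset by rewrite in_fsetU in_fset1 eqxx orbT.
    rewrite !(big_fsetD1 _ iS) /= eqxx.
    have E : \sum_(j <- ((S `|` [fset i]) `\ i)%fset) (if j == i then n else mu j) =
        \sum_(j <- ((S `|` [fset i]) `\ i)%fset) mu j.
      by apply: eq_big_seq => j; rewrite in_fsetD1 => /andP[/negbTE->].
    by rewrite E !addrA [x + _ + _]addrAC xy [y + c.1 + n]addrAC.
have ex2 i x v y w : exchange (g i) x v y w -> exchange (g i) y w x v ->
    h x + pi (d i v) = h y + pi (d i w).
  by move=> e1 e2; rewrite !hpi; apply: piE => // c m; split; exact: ex1.
have kD i v w : pi (d i (v + w)) = pi (d i v) + pi (d i w).
  rewrite -piD; [|exact: Dd|exact: Dd].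
  congr (pi (_, _)); first by rewrite addr0.
  apply: funext => j; transitivity ((d i v).2 j + (d i w).2 j); last by [].
  by rewrite /=; case: ifP; rewrite ?addr0.
exists N, h, (fun i => pi \o d i); split=> // i v m gvm.
apply: piV; first exact: Dd.
exists [fset i]%fset, (fun j => if j == i then m else 0); split=> [j|j|].
- by rewrite /=; case: eqP => [->//|_]; exact: gadget0.
- by rewrite in_fset1 => /negbTE->.
- by rewrite big_seq_fset1 eqxx add0r.
Qed.

(** * Gadgets for refinement and division problems *)

Notation nat4 := ((nat * nat) * (nat * nat))%type.

(* The [i, j, k, l] count the first row, second row, first column and second
   column of the formal matrix, which are worth [a0], [a1], [b0] and [b1]. *)
Definition refine_rel (M : nmodType) (a0 a1 b0 b1 : M) (v : nat4) (m : M) :=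
  exists i j k l : nat,
    v = ((i + k, i + l), (j + k, j + l))%N /\
    m = a0 *+ i + a1 *+ j + (b0 *+ k + b1 *+ l).

Definition total (v : nat4) : nat := (v.1.1 + v.1.2 + (v.2.1 + v.2.2))%N.

(* Each of the four generators of [nat4] is a formal [p]-th part of [a]. *)
Definition divide_rel (M : nmodType) (p : nat) (a : M) (v : nat4) (m : M) :=
  exists k : nat, total v = (p * k)%N /\ m = a *+ k.

Lemma nat4D (x y z t x' y' z' t' : nat) :
  ((x, y), (z, t)) + ((x', y'), (z', t')) =
  ((x + x', y + y'), (z + z', t + t'))%N :> nat4.
Proof. by []. Qed.

Lemma totalD (v w : nat4) : total (v + w) = (total v + total w)%N.
Proof.
case: v w => [[x y] [z t]] [[x' y'] [z' t']]; rewrite nat4D /total /=; lia.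
Qed.

Lemma mulrn_conical (M : nmodType) (a : M) (n : nat) :
  conical M -> a <> 0 -> a *+ n = 0 -> n = 0%N.
Proof. by move=> conM a0; case: n => // n; rewrite mulrS => /conM[]. Qed.

(** Equal diagonal sums suffice: when [x <= y], taking [x] first rows and [z] second rows leaves
    [y - x] second columns, and the other case is symmetric. *)
Lemma refine_relP (M : nmodType) (a0 a1 b0 b1 : M) (x y z t : nat) :
  (exists m, refine_rel a0 a1 b0 b1 ((x, y), (z, t)) m) <-> (x + t = y + z)%N.
Proof.
split=> [[m [i [j [k [l [[-> -> -> ->] _]]]]]]|xyzt]; first by lia.
have [xy|/ltnW yx] := leqP x y.
  exists (a0 *+ x + a1 *+ z + (b0 *+ 0 + b1 *+ (y - x))), x, z, 0%N, (y - x)%N.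
  by split=> //; congr (_, _, (_, _)); lia.
exists (a0 *+ y + a1 *+ t + (b0 *+ (x - y) + b1 *+ 0)), y, t, (x - y)%N, 0%N.
by split=> //; congr (_, _, (_, _)); lia.
Qed.

(** The only relation between rows and columns is that both rows together equal both columns
    together, and [a0 + a1 = b0 + b1] matches it. Nonzero data ensure that value zero occurs only
    for the zero matrix. *)
Lemma refine_gadget (M : nmodType) (a0 a1 b0 b1 : M) :
  conical M -> a0 + a1 = b0 + b1 ->
  a0 <> 0 -> a1 <> 0 -> b0 <> 0 -> b1 <> 0 ->
  gadget (refine_rel a0 a1 b0 b1).
Proof.
move=> conM ab a0N a1N b0N b1N; split.
- move=> _ m n [i [j [k [l [-> ->]]]]] [i' [j' [k' [l' [[e1 e2 e3 e4] ->]]]]].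
  wlog ii' : i j k l i' j' k' l' e1 e2 e3 e4 / (i <= i')%N.
    move=> W; have [|/ltnW] := leqP i i'; first exact: W.
    by move=> H; symmetry; apply: W.
  (* Two decompositions of one matrix differ by trading [s] copies of both columns for [s] copies of
     both rows. *)
  have [s [-> -> -> ->]] : exists s,
    [/\ i' = (s + i)%N, j' = (s + j)%N, k = (s + k')%N & l = (s + l')%N].
    by exists (i' - i)%N; split; lia.
  rewrite !mulrnDr (addrACA (b0 *+ s)) (addrACA (a0 *+ s)) -!mulrnDl ab.
  by rewrite -[RHS]addrA; exact: addrCA.
- by exists 0%N, 0%N, 0%N, 0%N; rewrite !mulr0n !addr0.
- move=> _ _ _ _ [i [j [k [l [-> ->]]]]] [i' [j' [k' [l' [-> ->]]]]].
  exists (i + i')%N, (j + j')%N, (k + k')%N, (l + l')%N.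
  split; first by rewrite nat4D; congr (_, _, (_, _)); lia.
  by rewrite !mulrnDr addrACA; congr (_ + _); rewrite addrACA.
- move=> [[x y] [z t]] [[x' y'] [z' t']] m n vm vwn; apply/refine_relP.
  move: vwn; rewrite nat4D => vwn.
  have /refine_relP := ex_intro _ n vwn; have /refine_relP := ex_intro _ m vm.
  by lia.
(* Adding the matrix with its columns swapped makes the diagonal sums equal. *)
- move=> [[x y] [z t]]; exists ((y, x), (t, z)).
  by rewrite nat4D; apply/refine_relP; lia.
- move=> [[x y] [z t]] [[x' y'] [z' t']] [i [j [k [l []]]]].
  rewrite nat4D => -[e1 e2 e3 e4].
  move=> /esym /conM[/conM[+ +] /conM[]].
  move=> /(mulrn_conical conM a0N) i0 /(mulrn_conical conM a1N) j0.
  move=> /(mulrn_conical conM b0N) k0 /(mulrn_conical conM b1N) l0.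
  exists 0%N, 0%N, 0%N, 0%N; rewrite !mulr0n !addr0; split=> //.
  by congr (_, _, (_, _)); lia.
Qed.

Lemma divide_gadget (M : nmodType) (p : nat) (a : M) :
  conical M -> (0 < p)%N -> a <> 0 -> gadget (divide_rel p a).
Proof.
move=> conM p0 aN; split.
- move=> v m n [k [vk ->]] [l [/eqP]].
  by rewrite vk eqn_pmul2l // => /eqP-> ->.
- by exists 0%N; rewrite muln0.
- move=> v w m n [k [vk ->]] [l [wl ->]]; exists (k + l)%N.
  by rewrite totalD vk wl mulnDr mulrnDr.
- move=> v w m n [k [vk _]] [l [+ _]]; rewrite totalD vk => kl.
  by exists (a *+ (l - k)), (l - k)%N; split=> //; rewrite mulnBr -kl addKn.
(* This complement raises the total from [total v] to [p] times [total v]. *)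
- move=> v; exists ((total v * p.-1)%N, 0%N, (0%N, 0%N)).
  exists (a *+ total v), (total v).
  split=> //; rewrite totalD /total /=; nia.
- move=> v w [k [vw /esym /(mulrn_conical conM aN) k0]]; exists 0%N; split=> //.
  by move: vw; rewrite k0 totalD; lia.
Qed.

(** * One step of the construction: solving all problems of a monoid *)

(** The division clause treats all [x] and [y] of [M] at once. In the colimit a finite set comes
    from a single stage, so this becomes normal divisibility. *)
Definition solves (M N : nmodType) (h : M -> N) : Prop :=
  (forall a0 a1 b0 b1 : M, a0 + a1 = b0 + b1 ->
     exists c00 c01 c10 c11 : N,
       [/\ h a0 = c00 + c01, h a1 = c10 + c11,
           h b0 = c00 + c10 & h b1 = c01 + c11]) /\
  (forall (p : nat) (a : M), (0 < p)%N ->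
     exists u : N, u *+ p = h a /\
       forall x y : M, x + a = y + a -> h x + u = h y + u).

Lemma solving_extension (M : nmodType) : conical M ->
  exists (N : nmodType) (h : {additive M -> N}),
    [/\ unitary h, preserves_classes M N & solves h].
Proof.
move=> conM.
(* Indexing by all gadgets on [nat4] handles refinement and division in a single extension. *)
pose I := {classic {g : nat4 -> M -> Prop | gadget g}}.
have [N [h [k [hU NM kD kE kex]]]] :=
  gadget_extension (V := nat4) (g := fun i : I => sval i) conM
    (fun i => svalP i).
exists N, h; split=> //; split.
  move=> a0 a1 b0 b1 ab.
  have hab : h a0 + h a1 = h b0 + h b1 by rewrite -!raddfD ab.
  (* A problem with a zero entry gives no gadget, but has an evident solution. *)
  have [a00|a0N] := pselect (a0 = 0).
    exists 0, 0, (h b0), (h b1); rewrite -hab a00 raddf0.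
    by rewrite !add0r; split.
  have [a10|a1N] := pselect (a1 = 0).
    exists (h b0), (h b1), 0, 0; rewrite -hab a10 raddf0.
    by rewrite !addr0; split.
  have [b00|b0N] := pselect (b0 = 0).
    exists 0, (h a0), 0, (h a1); rewrite hab b00 raddf0.
    by rewrite !add0r; split.
  have [b10|b1N] := pselect (b1 = 0).
    exists (h a0), 0, (h a1), 0; rewrite hab b10 raddf0.
    by rewrite !addr0; split.
  pose i : I := exist _ _ (refine_gadget conM ab a0N a1N b0N b1N).
  exists (k i (1, 0, (0, 0))%N), (k i (0, 1, (0, 0))%N),
    (k i (0, 0, (1, 0))%N), (k i (0, 0, (0, 1))%N).
  rewrite -!kD !nat4D; split; symmetry; apply: kE => /=.
  - by exists 1%N, 0%N, 0%N, 0%N; rewrite !mulr0n !addr0.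
  - by exists 0%N, 1%N, 0%N, 0%N; rewrite !mulr0n !addr0 add0r.
  - by exists 0%N, 0%N, 1%N, 0%N; rewrite !mulr0n !addr0 add0r.
  - by exists 0%N, 0%N, 0%N, 1%N; rewrite !mulr0n !add0r.
move=> p a p0; have [->|aN] := pselect (a = 0).
  exists 0; rewrite mul0rn raddf0; split=> // x y.
  by rewrite !addr0 => ->.
pose i : I := exist _ _ (divide_gadget conM p0 aN).
pose e : nat4 := (1, 0, (0, 0))%N.
exists (k i e); split.
  have kM n : k i e *+ n.+1 = k i (e *+ n.+1).
    elim: n => [|n IH]; first by rewrite !mulr1n.
    by rewrite mulrS IH -kD -mulrS.
  rewrite -(prednK p0) kM; apply: kE; exists 1%N; rewrite muln1; split=> //.
  rewrite (prednK p0); elim: (p) => // n IH.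
  by rewrite mulrS totalD IH.
move=> x y xy.
(* The generator [e] makes the total positive, so the value [m] contains a copy of [a], which
   absorbs the change from [x'] to [y']. *)
have ex x' y' : x' + a = y' + a -> exchange (sval i) x' e y' e.
  move=> xy' u m um; exists m => //; move: um => [[|l] [+ ->]].
    by rewrite totalD muln0 /total /=; lia.
  by move=> _; rewrite mulrS !addrA xy'.
by apply: kex; apply: ex.
Qed.

(** * Colimits of sequences of embeddings *)

Definition thread (M : nat -> nmodType) (f : forall n, M n -> M n.+1) (n : nat)
  (x : forall k, M k) : Prop := forall k, (n <= k)%N -> x k.+1 = f k (x k).

(** Shifting the whole sequence of monoids reduces to [n = 0], where plain recursion needs no cast;
    entries before [n] default to zero. *)
Lemma thread_exists (M : nat -> nmodType) (f : forall n, M n -> M n.+1)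
  (n : nat) (m : M n) : exists x : forall k, M k, x n = m /\ thread f n x.
Proof.
elim: n M f m => [|n IH] M f m.
  by exists (fun k => nat_rect M m f k).
have [x [xn fx]] := IH (fun k => M k.+1) (fun k => f k.+1) m.
exists (fun k => if k is k'.+1 then x k' else 0); split=> // -[//|k].
exact: fx.
Qed.

Lemma thread_eq (M : nat -> nmodType) (f : forall n, M n -> M n.+1) (n : nat)
    (x y : forall k, M k) : thread f n x -> thread f n y -> x n = y n ->
  forall k, (n <= k)%N -> x k = y k.
Proof.
move=> fx fy xy k /subnK <-; elim: (k - n)%N => // i IH.
by rewrite addSn fx ?leq_addl // fy ?leq_addl // IH.
Qed.

Lemma thread_inj (M : nat -> nmodType) (f : forall n, M n -> M n.+1) (n k : nat)
    (x y : forall k, M k) : (forall n, injective (f n)) ->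
  thread f n x -> thread f n y -> (n <= k)%N -> x k = y k -> x n = y n.
Proof.
move=> finj fx fy /subnK <-; elim: (k - n)%N => // i IH.
by rewrite addSn fx ?leq_addl // fy ?leq_addl // => /finj.
Qed.

(* The colimit is realised by eventually compatible sequences modulo eventual
   equality, so that no element is ever transported along an equation [n = k]. *)
Lemma colimit_exists (M : nat -> nmodType)
    (f : forall n, {additive M n -> M n.+1}) :
    (forall n, injective (f n)) ->
  exists (N : nmodType) (e : forall n, {additive M n -> N}),
    [/\ forall n x, e n.+1 (f n x) = e n x, forall n, injective (e n)
      & forall y, exists n x, e n x = y].
Proof.
move=> finj; pose A := forall n, M n.
pose add (x y : A) : A := fun n => x n + y n.
pose D (x : A) := exists n, thread f n x.
pose R (x y : A) := exists n, forall k, (n <= k)%N -> x k = y k.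
have thD n x y : thread f n x -> thread f n y -> thread f n (add x y).
  by move=> fx fy k nk; rewrite /add fx // fy // raddfD.
have thW n k x : thread f n x -> (n <= k)%N -> thread f k x.
  by move=> fx nk l kl; apply: fx; apply: leq_trans nk kl.
have DD x y : D x -> D y -> D (add x y).
  move=> [n fx] [k fy]; exists (maxn n k).
  by apply: thD; [apply: thW fx _|apply: thW fy _]; rewrite ?leq_maxl ?leq_maxr.
have [||||||||N [pi [pisurj pi0 piD piE]]] :=
    @subquotient A (fun=> 0) add D R _ DD.
- by exists 0%N => k _; rewrite raddf0.
- by move=> x; exists 0%N.
- by move=> x y [n xy]; exists n => k /xy.
- move=> x y z [n xy] [k yz]; exists (maxn n k) => l.
  by rewrite geq_max => /andP[/xy-> /yz].
- by move=> x y z [n xy]; exists n => k /xy; rewrite /add => ->.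
- by move=> x y z; exists 0%N => k _; rewrite /add addrA.
- by move=> x y; exists 0%N => k _; rewrite /add addrC.
- by move=> x; exists 0%N => k _; rewrite /add add0r.
have [t tP] := choice (fun p : {n & M n} =>
  thread_exists (fun n => f n) (tagged p)).
pose th n (m : M n) := t (Tagged M m).
have thn n m : th n m n = m by have [] := tP (Tagged M m).
have fth n m : thread f n (th n m) by have [] := tP (Tagged M m).
have Dth n m : D (th n m) by exists n.
have pith n x : thread f n x -> pi x = pi (th n (x n)).
  move=> fx; apply/piE => //; first by exists n.
  by exists n; apply: (thread_eq fx (fth _ _)); rewrite thn.
have eP n : exists e : {additive M n -> N}, forall m, e m = pi (th n m).
  apply: additive_of => [|m m'].
    by rewrite -pi0 -(pith n (fun=> 0)) // => k _; rewrite raddf0.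
  by rewrite -piD // (pith n (add _ _)) /add ?thn //; exact: thD.
pose e n := sval (cid (eP n)).
have eE n m : e n m = pi (th n m) by rewrite /e; case: cid.
exists N, e; split=> [n x|n x y|y].
- rewrite !eE (pith n.+1 (th n x)); last exact: thW (fth n x) _.
  by rewrite (fth n x) // thn.
- rewrite !eE => /(piE _ _ (Dth _ _) (Dth _ _))[k xy].
  rewrite -(thn n x) -(thn n y).
  by apply: (thread_inj finj (k := maxn n k)); rewrite ?leq_maxl ?xy ?leq_maxr.
- have [x [n fx] <-] := pisurj y.
  by exists n, (x n); rewrite eE -pith.
Qed.

(** * Iterating the one-step extension *)

Lemma solving_sequence (M : nmodType) : conical M ->
  exists (S : nat -> nmodType) (f : forall n, {additive S n -> S n.+1}),
    [/\ S 0%N = M & forall n, [/\ conical (S n), unitary (f n),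
      preserves_classes (S n) (S n.+1) & solves (f n)]].
Proof.
move=> conM.
(* Conicality is bundled with each stage because the next extension requires it. *)
have nxt (T : {T : nmodType | conical T}) :
    {N : {N : nmodType | conical N} & {h : {additive sval T -> sval N} |
      [/\ unitary h, preserves_classes (sval T) (sval N) & solves h]}}.
  case: T => T conT; have [N /cid[h hP]] := cid (solving_extension conT).
  have conN : conical N by case: hP => _ [/(_ conT)].
  by exists (exist _ N conN), h.
pose S n := iter n (fun T => projT1 (nxt T)) (exist _ M conM).
exists (fun n => sval (S n)), (fun n => sval (projT2 (nxt (S n)))).
by split=> // n; have [] := svalP (projT2 (nxt (S n))); split=> //; apply: svalP.
Qed.

Lemma divisible_refinement_extension (M : nmodType) : conical M ->
  exists (N : nmodType) (h : {additive M -> N}),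
    [/\ unitary h, preserves_classes M N, refinement_property N
      & normally_divisible N].
Proof.
move=> /solving_sequence[S [f [<- SP]]].
have finj n : injective (f n) by have [_ []] := SP n.
have [N [e [eS einj esurj]]] := colimit_exists finj.
have up n (x : S n) k : (n <= k)%N -> exists y : S k, e k y = e n x.
  move=> /subnK <-; elim: (k - n)%N => [|i [y <-]]; first by exists x.
  by exists (f _ y); rewrite eS.
have ev y : exists n, forall k, (n <= k)%N -> exists x : S k, e k x = y.
  by have [n [x <-]] := esurj y; exists n => k; apply: up.
(* A finite list comes from one common stage, where each required property of [N] can be checked. *)
have evs (s : seq N) :
    exists n, forall y, y \in s -> exists x : S n, e n x = y.
  suff [n H] : exists n, forall k, (n <= k)%N ->
      forall y, y \in s -> exists x : S k, e k x = y.
    by exists n; apply: H.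
  elim: s => [|y s [n IH]]; first by exists 0%N.
  have [m my] := ev y; exists (maxn m n) => k; rewrite geq_max => /andP[mk nk] z.
  by rewrite in_cons => /predU1P[->|zs]; [apply: my|apply: IH].
exists N, (e 0%N); split.
- split; first exact: einj.
  + move=> b; have [n [x <-]] := esurj b.
    elim: n x => [|n IH] x; first by exists x, 0; rewrite addr0.
    have [_ [_ /(_ x)[a [z xz]] _] _ _] := SP n.
    have [a' [z' az]] := IH a; exists a', (e _ z + z').
    by rewrite addrA -raddfD xz eS az.
  (* Descent on the stage of [b]: unitarity of [f n] brings [b] from stage [n.+1] down to stage
     [n]. *)
  + move=> a0 a1 b; have [n [x <-]] := esurj b.
    elim: n x => [|n IH] x; first by exists x.
    have [b0 b0E] := up _ a0 n isT; have [b1 b1E] := up _ a1 n isT.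
    move=> E; have := E.
    rewrite -b0E -b1E -(eS _ b0) -(eS _ b1) -raddfD => /einj.
    have [_ [_ _ H] _ _] := SP n => /H [c cx].
    by move: E; rewrite -cx eS; apply: IH.
- have PS n : preserves_classes (S 0%N) (S n).
    elim: n => // n [c1 c2 c3]; have [_ _ [d1 d2 d3] _] := SP n.
    by split=> [/c1|/c2|/c3].
  split=> [con0 x y|can0 x y z|sep0 x y].
  + have [n H] := evs [:: x; y].
    have [|x' <-] := H x; rewrite ?inE ?eqxx //.
    have [|y' <-] := H y; rewrite ?inE ?eqxx ?orbT //.
    rewrite -raddfD -(raddf0 (e n)) => /einj.
    by have [/(_ con0) conn _ _] := PS n => /conn [-> ->].
  + have [n H] := evs [:: x; y; z].
    have [|x' <-] := H x; rewrite ?inE ?eqxx //.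
    have [|y' <-] := H y; rewrite ?inE ?eqxx ?orbT //.
    have [|z' <-] := H z; rewrite ?inE ?eqxx ?orbT //.
    rewrite -!raddfD => /einj.
    by have [_ /(_ can0) cann _] := PS n => /cann ->.
  + have [n H] := evs [:: x; y].
    have [|x' <-] := H x; rewrite ?inE ?eqxx //.
    have [|y' <-] := H y; rewrite ?inE ?eqxx ?orbT //.
    rewrite -!raddfMn -!raddfD => /einj xy /einj yx; congr (e n _).
    by have [_ _ /(_ sep0) sepn] := PS n; apply: sepn.
- move=> a0 a1 b0 b1; have [n H] := evs [:: a0; a1; b0; b1].
  have [|a0' <-] := H a0; rewrite ?inE ?eqxx //.
  have [|a1' <-] := H a1; rewrite ?inE ?eqxx ?orbT //.
  have [|b0' <-] := H b0; rewrite ?inE ?eqxx ?orbT //.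
  have [|b1' <-] := H b1; rewrite ?inE ?eqxx ?orbT //.
  rewrite -!raddfD => /einj; have [_ _ _ [+ _]] := SP n => K /K.
  move=> [c00 [c01 [c10 [c11 [E1 E2 E3 E4]]]]].
  exists (e _ c00), (e _ c01), (e _ c10), (e _ c11).
  by rewrite -!raddfD -E1 -E2 -E3 -E4 !eS.
- move=> p X a p0; have [n H] := evs (a :: X).
  have [|a' aE] := H a; rewrite ?inE ?eqxx //.
  have [_ _ _ [_ /(_ p a' p0)[u [ua uP]]]] := SP n.
  exists (e _ u); split; first by rewrite -raddfMn ua eS.
  move=> x y xX yX; have [|x' <-] := H x; rewrite ?inE ?xX ?orbT //.
  have [|y' <-] := H y; rewrite ?inE ?yX ?orbT //.
  by rewrite -aE -!raddfD => /einj /uP E; rewrite -(eS _ x') -(eS _ y') -!raddfD E.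
Qed.

(** * Order-ideals and order-units in refinement monoids *)

Section Domination.
Variable N : nmodType.
Implicit Types a b c d x y z u : N.

(** Membership of [a] in the order-ideal generated by [b]. *)
Definition dom a b : Prop := exists n, alg_le a (b *+ n).

(** This amounts to being an order-unit: allowing the multiple zero changes nothing, since an
    element below [0] is also below [u]. *)
Definition full u : Prop := forall x, dom x u.

Lemma le_dom a b : alg_le a b -> dom a b.
Proof. by exists 1%N. Qed.

Lemma alg_le_refl a : alg_le a a.
Proof. by exists 0; rewrite addr0. Qed.

Lemma alg_le_trans a b c : alg_le a b -> alg_le b c -> alg_le a c.
Proof. by move=> [x <-] [y <-]; exists (x + y); rewrite addrA. Qed.

Lemma alg_leDl a b : alg_le a (a + b).
Proof. by exists b. Qed.

Lemma alg_leDr a b : alg_le b (a + b).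
Proof. by exists a; rewrite addrC. Qed.

Lemma alg_leD a b c d : alg_le a b -> alg_le c d -> alg_le (a + c) (b + d).
Proof. by move=> [x <-] [y <-]; exists (x + y); rewrite addrACA. Qed.

Lemma alg_leMn a b n : alg_le a b -> alg_le (a *+ n) (b *+ n).
Proof. by move=> [x <-]; exists (x *+ n); rewrite mulrnDl. Qed.

Lemma dom_trans a b c : dom a b -> dom b c -> dom a c.
Proof.
move=> [n ab] [k bc]; exists (k * n)%N; rewrite mulrnA.
exact: alg_le_trans ab (alg_leMn n bc).
Qed.

Lemma domD a b c : dom a c -> dom b c -> dom (a + b) c.
Proof.
by move=> [n ac] [k bc]; exists (n + k)%N; rewrite mulrnDr; apply: alg_leD.
Qed.

Lemma full_dom u v : full u -> dom u v -> full v.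
Proof. by move=> fu uv x; apply: dom_trans (fu x) uv. Qed.

Hypothesis refN : refinement_property N.

Lemma riesz a b c : alg_le a (b + c) ->
  exists a1 a2, [/\ a = a1 + a2, alg_le a1 b & alg_le a2 c].
Proof.
move=> [z /refN[p [q [r [s [-> _ -> ->]]]]]].
by exists p, q; split=> //; apply: alg_leDl.
Qed.

Lemma dom_split a b c : dom a (b + c) ->
  exists a1 a2, [/\ a = a1 + a2, dom a1 b & dom a2 c].
Proof.
move=> [n]; rewrite mulrnDl => /riesz[a1 [a2 [-> ab ac]]].
by exists a1, a2; split=> //; exists n.
Qed.

(** By induction on the multiple of [b]: split [a] as [a1 + a2], with [a1] below [b] and [d] already
    found for [a2]. Refining [a1 + r = d + s] isolates the part [t] of [d] outside [a1], and
    [a1 + t] stays below [b]. *)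
Lemma dom_common a b : dom a b ->
  exists d, [/\ alg_le d a, alg_le d b & dom a d].
Proof.
move=> [n]; elim: n a => [|n IH] a.
  rewrite mulr0n => a0; exists 0; split; [| |by exists 0%N].
    by exists a; rewrite add0r.
  by exists b; rewrite add0r.
rewrite mulrS => /riesz[a1 [a2 [-> [r a1r] /IH[d [da2 [s ds] a2d]]]]].
have /refN[p [q [t [w [a1E rE dE _]]]]] : a1 + r = d + s by rewrite a1r.
have t_le_d : alg_le t d by rewrite dE; exact: alg_leDr.
exists (a1 + t); split.
- by apply: alg_leD (alg_le_refl _) _; apply: alg_le_trans t_le_d da2.
- by rewrite -a1r rE addrA; exact: alg_leDl.
- apply: domD; first exact/le_dom/alg_leDl.
  apply: dom_trans a2d _; apply: le_dom.
  by rewrite dE a1E addrAC; exact: alg_leDl.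
Qed.

Definition below_both x a b : Prop := alg_le x a /\ alg_le x b.

Lemma below_both_common a b x : dom x a -> alg_le x b ->
  exists2 d, below_both d a b & dom x d.
Proof.
move=> /dom_common[d [dx da xd]] xb; exists d => //; split=> //.
exact: alg_le_trans dx xb.
Qed.

(** Splitting [a] along [c + d], then its first piece along [b + d], leaves one piece dominated by
    both [b] and [c] and two dominated by [d]. Each piece is replaced by a common part that still
    dominates it. *)
Lemma diagonal_cover a b c d : full (c + d) -> full (b + d) ->
  exists x1 x2 y, [/\ below_both x1 a d, below_both x2 a d, below_both y b c
    & dom a (x1 + x2 + y)].
Proof.
move=> fcd fbd; have [f [g [aE fc gd]]] := dom_split (fcd a).
have [f1 [f2 [fE f1b f2d]]] := dom_split (fbd f).
have f_le_a : alg_le f a by rewrite aE; exact: alg_leDl.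
have f2_le_a : alg_le f2 a.
  by apply: alg_le_trans f_le_a; rewrite fE; exact: alg_leDr.
have [x1 [x1d x1a] gx1] : exists2 x, below_both x d a & dom g x.
  by apply: below_both_common => //; rewrite aE; exact: alg_leDr.
have [x2 [x2d x2a] f2x2] := below_both_common f2d f2_le_a.
have [|z [zf1 zc f1z]] := @dom_common f1 c.
  by apply: dom_trans fc; apply: le_dom; rewrite fE; exact: alg_leDl.
have [y yP zy] := below_both_common (dom_trans (le_dom zf1) f1b) zc.
exists x1, x2, y; split=> //; rewrite aE fE.
have le1 : alg_le (x1 + x2) (x1 + x2 + y) by exact: alg_leDl.
apply: domD; last first.
  by apply: dom_trans gx1 (le_dom (alg_le_trans (alg_leDl _ _) le1)).
apply: domD; last first.
  by apply: dom_trans f2x2 (le_dom (alg_le_trans (alg_leDr _ _) le1)).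
exact: dom_trans f1z (dom_trans zy (le_dom (alg_leDr _ _))).
Qed.

Lemma full_refinement a0 a1 b0 b1 : normally_divisible N ->
  full a0 -> full a1 -> full b0 -> full b1 -> a0 + a1 = b0 + b1 ->
  exists c00 c01 c10 c11 : N,
    [/\ [/\ full c00, full c01, full c10 & full c11],
        a0 = c00 + c01, a1 = c10 + c11, b0 = c00 + c10 & b1 = c01 + c11].
Proof.
move=> divN fa0 fa1 fb0 fb1 /refN[c00 [c01 [c10 [c11 [a0E a1E b0E b1E]]]]].
(* Three copies of each entry make room for a sum of three common parts; the fourth copy stays in
   place. *)
have quarter c : exists e, c = e *+ 4.
  by have [e [eE _]] := divN 4 fset0 c isT; exists e.
have full4 x y : full (x *+ 4 + y *+ 4) -> full (x + y).
  by rewrite -mulrnDl => f4; apply: full_dom f4 _; exists 4; exact: alg_le_refl.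
have [e00 e00E] := quarter c00; have [e01 e01E] := quarter c01.
have [e10 e10E] := quarter c10; have [e11 e11E] := quarter c11.
move: a0E a1E b0E b1E fa0 fa1 fb0 fb1; rewrite {}e00E {}e01E {}e10E {}e11E.
move=> -> -> -> -> /full4 fr0 /full4 fr1 /full4 fc0 /full4 fc1.
have [x1 [x2 [y3 [[x1a x1d] [x2a x2d] [y3b y3c] cov0]]]] :=
  @diagonal_cover e00 e01 e10 e11 fr1 fc1.
have [y1 [y2 [x3 [[y1b y1c] [y2b y2c] [x3a x3d] cov1]]]] :
    exists y1 y2 x3, [/\ below_both y1 e01 e10, below_both y2 e01 e10,
      below_both x3 e00 e11 & dom e01 (y1 + y2 + x3)].
  by apply: diagonal_cover; [rewrite addrC|].
pose x := x1 + x2 + x3; pose y := y1 + y2 + y3.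
have le3 u v w e : alg_le u e -> alg_le v e -> alg_le w e ->
    exists r, u + v + w + r = e *+ 3.
  by move=> ue ve we; rewrite !mulrS mulr0n addr0 addrA; do 2!apply: alg_leD => //.
have [r00 E00] : exists r, x + r = e00 *+ 3 by exact: le3.
have [r11 E11] : exists r, x + r = e11 *+ 3 by exact: le3.
have [r01 E01] : exists r, y + r = e01 *+ 3 by exact: le3.
have [r10 E10] : exists r, y + r = e10 *+ 3 by exact: le3.
(* Together [x] and [y] dominate [e00] and [e01], whose sum is the full first row. *)
have fxy : full (x + y).
  apply: full_dom fr0 _; apply: domD.
    apply: dom_trans cov0 (le_dom _); apply: alg_leD; first exact: alg_leDl.
    exact: alg_leDr.
  apply: dom_trans cov1 (le_dom _); rewrite addrC [x + y]addrC addrC.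
  by apply: alg_leD; [exact: alg_leDl|exact: alg_leDr].
(* After [u] is replaced by [v], the remaining copy of [e] still dominates [u], so the new entry
   dominates [u + v]. *)
have full_part u v e r : full (u + v) -> alg_le u (e *+ 3) -> full (e + r + v).
  move=> fuv ue; apply: full_dom fuv _; apply: domD; last exact/le_dom/alg_leDr.
  apply: (@dom_trans _ e); first by exists 3.
  by apply: le_dom; rewrite -addrA; exact: alg_leDl.
have fyx : full (y + x) by rewrite addrC.
(* Neighbouring entries exchange [u] and [v], which preserves every row and column sum. *)
have swap e r u e' r' v : u + r = e *+ 3 -> v + r' = e' *+ 3 ->
    e *+ 4 + e' *+ 4 = (e + r + v) + (e' + r' + u).
  move=> ur vr'; rewrite (mulrS e 3) (mulrS e' 3) -ur -vr'.
  by rewrite (AC ((1*2)*(1*2)) ((1*3*5)*(4*6*2))).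
exists (e00 + r00 + y), (e01 + r01 + x), (e10 + r10 + x), (e11 + r11 + y).
split; try exact: swap; first split.
- by apply: full_part fxy _; exists r00.
- by apply: full_part fyx _; exists r01.
- by apply: full_part fyx _; exists r10.
- by apply: full_part fxy _; exists r11.
Qed.

End Domination.

(** * Restriction to zero and the order-units *)

Lemma submonoid_exists (A : nmodType) (D : A -> Prop) :
    D 0 -> (forall x y, D x -> D y -> D (x + y)) ->
  exists (S : nmodType) (i : {additive S -> A}),
    injective i /\ forall x, D x <-> exists s, i s = x.
Proof.
move=> D0 DD; have [|||||||S [pi [pisurj pi0 piD piE]]] :=
  @subquotient A 0 +%R D eq D0 DD; [by []|by move=> x y ->|by move=> x y z ->|
  by move=> x y z ->|exact: addrA|exact: addrC|exact: add0r|].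
have repP s : exists x, D x /\ pi x = s by have [x Dx <-] := pisurj s; exists x.
have [r rP] := choice repP.
have rD s : D (r s) by have [] := rP s.
have rK s : pi (r s) = s by have [] := rP s.
have piK x : D x -> r (pi x) = x by move=> Dx; apply/piE.
have [i iE] : exists i : {additive S -> A}, forall s, i s = r s.
  apply: additive_of => [|s t]; first by rewrite -pi0 piK.
  by rewrite -{1}(rK s) -{1}(rK t) -piD // piK //; exact: DD.
exists S, i; split=> [s t|x]; first by rewrite !iE -{2}(rK s) -{2}(rK t) => ->.
by split=> [Dx|[s <-]]; [exists (pi x); rewrite iE piK|rewrite iE].
Qed.

Lemma injective_classes (A B : nmodType) (i : {additive A -> B}) :
  injective i -> preserves_classes B A.
Proof.
move=> inj; split=> [con x y xy|can x y z xyz|sep x y xy yx]; last 2 first.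
- by apply/inj/(can _ _ (i z)); rewrite -!raddfD xyz.
- by apply/inj/sep; rewrite -raddfMn -raddfD (xy, yx) // raddfMn.
have /con[] : i x + i y = 0 by rewrite -raddfD xy raddf0.
by split; apply: inj; rewrite raddf0.
Qed.

Theorem corollary2p7 (C : nmodType -> Prop)
  (hC : [\/ C = cone, C = cancellative_cone | C = separative_cone])
  (M : nmodType) (hM : C M) (simpleM : simple_monoid M) :
  exists N : nmodType,
    [/\ simple_monoid N, normally_divisible N, refinement_cone N, C N
      & embeds_unitarily M N].
Proof.
have conM : conical M by case: hC hM => -> // -[].
have [P [h [[hinj hcof hsub] [MP1 MP2 MP3] refP divP]]] :=
  divisible_refinement_extension conM.
have conP := MP1 conM.
pose D (x : P) := x = 0 \/ full x.
have DD x y : D x -> D y -> D (x + y).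
  move=> [->|fx]; first by rewrite add0r.
  by move=> _; right; apply: full_dom fx (le_dom (alg_leDl _ _)).
have [N [i [iinj iD]]] := submonoid_exists (or_introl (erefl 0) : D 0) DD.
have [PN1 PN2 PN3] := injective_classes iinj.
have conN := PN1 conP.
have iN s : s <> 0 -> full (i s).
  move=> s0; have [i0|//] : D (i s) by apply/iD; exists s.
  by case: s0; apply: iinj; rewrite raddf0.
have Nfull x : full x -> exists s, i s = x by move=> fx; apply/iD; right.
have hD m : D (h m).
  have [->|m0] := pselect (m = 0); first by left; rewrite raddf0.
  right=> x; have [a xa] := hcof x.
  (* By conicality a nonzero [m] is not below [0], so simplicity applies; cofinality of [h] then
     makes [h m] full in [P]. *)
  have m_unit : order_unit m.
    by apply: simpleM => -[z /conM[]].
  have [n _ [z az]] := m_unit a; exists n.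
  by apply: alg_le_trans xa _; exists (h z); rewrite -raddfD az raddfMn.
exists N; split.
- move=> u u0; have fu : full (i u).
    by apply: iN => u00; apply: u0; rewrite u00; exact: alg_le_refl.
  move=> x; have [n [z xz]] := fu (i x).
  (* The difference [z] may lie outside the submonoid; adding [i u] makes it full, at the cost of
     one more copy of [u]. *)
  have [s sE] : exists s, i s = z + i u.
    by apply: Nfull; apply: full_dom fu (le_dom (alg_leDr _ _)).
  exists n.+1 => //; exists s; apply: iinj.
  by rewrite raddfD sE addrA xz raddfMn mulrSr.
- move=> p X a p0.
  have [u [ua uX]] := divP p [fset i x | x in X]%fset (i a) p0.
  have [v vE] : exists v, i v = u.
    (* For [a = 0] conicality gives [u = 0]; otherwise [u] is full because its multiple [i a] is. *)
    have [a0|a0] := pselect (a = 0).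
      exists 0; rewrite raddf0; move: ua; rewrite a0 raddf0.
      by rewrite -(prednK p0) mulrS => /conP[].
    apply: Nfull; apply: full_dom (iN _ a0) _.
    by exists p; rewrite ua; exact: alg_le_refl.
  exists v; split; first by apply: iinj; rewrite raddfMn vE.
  move=> x y xX yX xy; apply: iinj; rewrite !raddfD vE; apply: uX.
  + by apply/imfsetP; exists x.
  + by apply/imfsetP; exists y.
  + by rewrite -!raddfD xy.
- split=> // a0 a1 b0 b1 ab.
  have [a00|a0N] := pselect (a0 = 0).
    by exists 0, 0, b0, b1; rewrite -ab a00 !add0r.
  have [a10|a1N] := pselect (a1 = 0).
    by exists b0, b1, 0, 0; rewrite -ab a10 !addr0.
  have [b00|b0N] := pselect (b0 = 0).
    by exists 0, a0, 0, a1; rewrite ab b00 !add0r.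
  have [b10|b1N] := pselect (b1 = 0).
    by exists a0, 0, a1, 0; rewrite ab b10 !addr0.
  have iab : i a0 + i a1 = i b0 + i b1 by rewrite -!raddfD ab.
  have [c00 [c01 [c10 [c11 [[f00 f01 f10 f11] E1 E2 E3 E4]]]]] :=
    full_refinement refP divP (iN _ a0N) (iN _ a1N) (iN _ b0N) (iN _ b1N) iab.
  have [d00 d00E] := Nfull _ f00; have [d01 d01E] := Nfull _ f01.
  have [d10 d10E] := Nfull _ f10; have [d11 d11E] := Nfull _ f11.
  exists d00, d01, d10, d11.
  by split; apply: iinj; rewrite raddfD ?E1 ?E2 ?E3 ?E4 ?d00E ?d01E ?d10E ?d11E.
- by case: hC hM => -> // -[_ cM]; split=> //; [exact/PN2/MP2|exact/PN3/MP3].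
have [g gE] := choice (fun m => proj1 (iD (h m)) (hD m)).
have [k kE] : exists k : {additive M -> N}, forall m, k m = g m.
  apply: additive_of => [|m n]; apply: iinj; first by rewrite gE !raddf0.
  by rewrite raddfD !gE raddfD.
have ikE m : i (k m) = h m by rewrite kE gE.
exists k; split.
- by move=> m n /(congr1 i); rewrite !ikE => /hinj.
- move=> b; have [a [z bz]] := hcof (i b).
  have [a0|aN] := hD a.
    exists a, 0; apply: iinj; move: bz; rewrite a0 addr0 ikE a0.
    by move=> /conP[].
  (* Again the difference is made full by adding [h a], so the bound becomes [a + a]. *)
  have [s sE] : exists s, i s = z + h a.
    by apply: Nfull; apply: full_dom aN (le_dom (alg_leDr _ _)).
  exists (a + a), s; apply: iinj.
  by rewrite ikE !raddfD sE addrA bz.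
- move=> m n b /(congr1 i); rewrite raddfD !ikE => /hsub[a aE].
  by exists a; apply: iinj; rewrite ikE.
Qed.
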